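(* Let $p_p,E_S,E_R>0$ be fixed (independent of $M$), and let $p_S=E_S/M$ and $p_R=E_R/M$. With all remaining parameters fixed, as $M\to\infty$ the rate expression $\tilde R_k$ defined in the context satisfies $$\tilde R_k\to\frac{\tau_c-2\tau_p}{\tau_c}\log_2\left(1+\frac{\theta}{1-\theta+\frac{1}{\alpha E_S\sigma_{SR,k}^2}+\frac{\sum_{i=1}^K\sigma_{SR,i}^4\sigma_{RD,i}^2}{E_R\sigma_{SR,k}^4\sigma_{RD,k}^4}}\right).$$
   Context: $\tilde R_k$ is the (large-antenna approximated) rate of the $k$-th of $K$ users in a relaying system with $M$ relay antennas and low-resolution ADCs at relay (parameter $\alpha\in(0,1]$) and destinations (parameter $\theta\in(0,1]$). Parameters: $p_S,p_R,p_p>0$, $\tau_c>2\tau_p>0$, $\sigma_{LI}^2\ge0$, $\beta_{SR,i},\beta_{RD,i}>0$, and $\sigma_{SR,i}^2=\frac{\alpha\tau_pp_p\beta_{SR,i}^2}{1+\tau_pp_p\beta_{SR,i}}$, $\sigma_{RD,i}^2=\frac{\alpha\tau_pp_p\beta_{RD,i}^2}{1+\tau_pp_p\beta_{RD,i}}$ for $i=1,\dots,K$. By definition $$\tilde R_k=\frac{\tau_c-2\tau_p}{\tau_c}\log_2\left(1+\frac{\tilde A_k}{\tilde B_k+\tilde C_k+\tilde D_k+\tilde E_k+\tilde F_k+\tilde G_k+\tilde H_k}\right)$$ with - $\tilde A_k=p_SM\sigma_{SR,k}^2\sigma_{RD,k}^2$; - $\tilde B_k=p_S(\beta_{SR,k}\sigma_{RD,k}^2+\beta_{RD,k}\sigma_{SR,k}^2)$;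 - $\tilde C_k=p_S\sum_{j\ne k}\Big(\sigma_{RD,k}^2\beta_{SR,j}+\frac{\beta_{RD,k}\sigma_{SR,j}^4\sigma_{RD,j}^2}{\sigma_{SR,k}^2\sigma_{RD,k}^2}\Big)$; - $\tilde D_k=p_R\sigma_{LI}^2\sigma_{RD,k}^2$; $\tilde E_k=\sigma_{RD,k}^2$; - $\tilde F_k=\frac{1-\alpha}{\alpha}\sigma_{RD,k}^2\big(p_S(\sigma_{SR,k}^2+\sum_{i=1}^K\beta_{SR,i})+p_R\sigma_{LI}^2+1\big)$; - $\tilde G_k=\frac{p_S}{p_R\sigma_{SR,k}^2\sigma_{RD,k}^2}\sum_{i=1}^K\sigma_{SR,i}^4\sigma_{RD,i}^2$; - $\tilde H_k=\frac{1-\theta}{\theta}p_S\Big(M\sigma_{SR,k}^2\sigma_{RD,k}^2+\frac{\sigma_{SR,k}^2\beta_{RD,k}}{\sigma_{RD,k}^2}\sum_{i=1}^K\sigma_{RD,i}^2\Big)+\frac{1-\theta}{\theta}p_S\sigma_{RD,k}^2\Big(\sum_{i=1}^K\beta_{SR,i}+\frac{p_R\sigma_{LI}^2+1}{\alpha p_S}\Big)+\frac{(1-\alpha)(1-\theta)}{\alpha\theta}\sigma_{RD,k}^2p_S\Big(\sigma_{SR,k}^2+\sum_{i=1}^K\beta_{SR,i}\Big)+\frac{(1-\theta)p_S\sum_{i=1}^K\sigma_{SR,i}^4\sigma_{RD,i}^2}{\theta p_R\sigma_{SR,k}^2\sigma_{RD,k}^2}$. *)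

(* Defs.v *)
From mathcomp Require Import all_boot all_order all_algebra.
From mathcomp Require Import all_classical all_reals all_analysis.
Set Implicit Arguments.
Unset Strict Implicit.
Unset Printing Implicit Defensive.
Import Order.TTheory GRing.Theory Num.Theory.
Import numFieldNormedType.Exports.
Local Open Scope ring_scope.

(* The parameters that do not depend on the number M of relay antennas.  In
   names, a trailing 2 marks a squared symbol: [sigmaLI2] is sigma_LI^2 and
   [sigmaSR2 P i] is sigma_{SR,i}^2, so that sigma_{SR,i}^4 is
   [sigmaSR2 P i ^+ 2]. *)
Record params (R : realType) (K : nat) := Params {
  alpha : R;           (* ADC parameter at the relay *)
  theta : R;           (* ADC parameter at the destinations *)
  tauc : R;            (* coherence interval *)
  taup : R;            (* pilot length *)
  pp : R;              (* pilot power *)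
  sigmaLI2 : R;        (* loop interference *)
  betaSR : 'I_K -> R;  (* large-scale fading, source i to relay *)
  betaRD : 'I_K -> R   (* large-scale fading, relay to destination i *)
}.

Definition log2 (R : realType) (x : R) : R := ln x / ln 2.

Section Rate.
Variables (R : realType) (K : nat) (P : params R K).

Definition sigmaSR2 (i : 'I_K) : R :=
  alpha P * taup P * pp P * betaSR P i ^+ 2 / (1 + taup P * pp P * betaSR P i).

Definition sigmaRD2 (i : 'I_K) : R :=
  alpha P * taup P * pp P * betaRD P i ^+ 2 / (1 + taup P * pp P * betaRD P i).

Variables (M : nat) (pS pR : R) (k : 'I_K).

Definition termA : R := pS * M%:R * sigmaSR2 k * sigmaRD2 k.

Definition termB : R :=
  pS * (betaSR P k * sigmaRD2 k + betaRD P k * sigmaSR2 k).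

Definition termC : R :=
  pS * \sum_(j < K | j != k)
         (sigmaRD2 k * betaSR P j
          + betaRD P k * sigmaSR2 j ^+ 2 * sigmaRD2 j
            / (sigmaSR2 k * sigmaRD2 k)).

Definition termD : R := pR * sigmaLI2 P * sigmaRD2 k.

Definition termE : R := sigmaRD2 k.

Definition termF : R :=
  (1 - alpha P) / alpha P * sigmaRD2 k
  * (pS * (sigmaSR2 k + \sum_(i < K) betaSR P i) + pR * sigmaLI2 P + 1).

Definition termG : R :=
  pS / (pR * sigmaSR2 k * sigmaRD2 k)
  * \sum_(i < K) sigmaSR2 i ^+ 2 * sigmaRD2 i.

Definition termH : R :=
  (1 - theta P) / theta P * pS
    * (M%:R * sigmaSR2 k * sigmaRD2 k
       + sigmaSR2 k * betaRD P k / sigmaRD2 k * \sum_(i < K) sigmaRD2 i)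
  + (1 - theta P) / theta P * pS * sigmaRD2 k
    * (\sum_(i < K) betaSR P i + (pR * sigmaLI2 P + 1) / (alpha P * pS))
  + (1 - alpha P) * (1 - theta P) / (alpha P * theta P) * sigmaRD2 k * pS
    * (sigmaSR2 k + \sum_(i < K) betaSR P i)
  + (1 - theta P) * pS * (\sum_(i < K) sigmaSR2 i ^+ 2 * sigmaRD2 i)
    / (theta P * pR * sigmaSR2 k * sigmaRD2 k).

Definition rate : R :=
  (tauc P - 2 * taup P) / tauc P
  * log2 (1 + termA / (termB + termC + termD + termE + termF + termG + termH)).

End Rate.

(* Main.v *)
Require Import Defs.
From mathcomp Require Import all_boot all_order all_algebra.
From mathcomp Require Import all_classical all_reals all_analysis.
From mathcomp Require Import ring.
Import Order.TTheory GRing.Theory Num.Theory.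
Import numFieldNormedType.Exports.
Local Open Scope classical_set_scope.
Local Open Scope ring_scope.

(* With p_S = E_S / M and p_R = E_R / M, for M > 0 the numerator of the SINR does
   not depend on M and its denominator is affine in 1 / M, with a positive
   constant term; the rate is thus a function of 1 / M that is continuous at 0. *)

Definition rate_denominator {R : realType} {K : nat} (P : params R K) (M : nat)
    (pS pR : R) (k : 'I_K) : R :=
  termB P pS k + termC P pS k + termD P pR k + termE P k + termF P pS pR k
  + termG P pS pR k + termH P M pS pR k.

(** The first summand collects [termE], the constant part of [termF] and the [1 / (alpha P * pS)]
    part of [termH]; the second is the part of [termH] with the factor [M]; the third joins [termG]
    to the last part of [termH]. *)
Definition limit_denominator {R : realType} {K : nat} (P : params R K)
    (ES ER : R) (k : 'I_K) : R :=
  sigmaRD2 P k / (alpha P * theta P)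
  + (1 - theta P) / theta P * (ES * sigmaSR2 P k * sigmaRD2 P k)
  + ES * (\sum_(i < K) sigmaSR2 P i ^+ 2 * sigmaRD2 P i)
    / (theta P * ER * sigmaSR2 P k * sigmaRD2 P k).

Lemma sigmaSR2_gt0 (R : realType) (K : nat) (P : params R K) (i : 'I_K) :
  0 < alpha P -> 0 < taup P -> 0 < pp P -> 0 < betaSR P i -> 0 < sigmaSR2 P i.
Proof.
move=> a0 t0 p0 b0; rewrite /sigmaSR2 divr_gt0 ?addr_gt0 ?mulr_gt0 ?exprn_gt0 //.
Qed.

Lemma sigmaRD2_gt0 (R : realType) (K : nat) (P : params R K) (i : 'I_K) :
  0 < alpha P -> 0 < taup P -> 0 < pp P -> 0 < betaRD P i -> 0 < sigmaRD2 P i.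
Proof.
move=> a0 t0 p0 b0; rewrite /sigmaRD2 divr_gt0 ?addr_gt0 ?mulr_gt0 ?exprn_gt0 //.
Qed.

(** The products [pS * M] and the ratios [pS / pR] are free of [M], and [pS] cancels in
    [pS * (1 / (alpha P * pS))]; every other occurrence of the powers is linear. *)
Lemma rate_denominator_affine (R : realType) (K : nat) (P : params R K)
    (ES ER : R) (k : 'I_K) :
  alpha P != 0 -> theta P != 0 -> ES != 0 -> ER != 0 ->
  sigmaSR2 P k != 0 -> sigmaRD2 P k != 0 ->
  exists c : R, forall M : nat, (0 < M)%N ->
    rate_denominator P M (ES / M%:R) (ER / M%:R) k
    = limit_denominator P ES ER k + c * M%:R^-1.
Proof.
move=> a0 t0 ES0 ER0 s0 d0.
rewrite /rate_denominator /limit_denominator.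
rewrite /termB /termC /termD /termE /termF /termG /termH.
move: (sigmaSR2 P k) (sigmaRD2 P k) s0 d0 => s d s0 d0.
set C := \sum_(j < K | _) _.
set S := \sum_(i < K) _ ^+ 2 * _.
set T := \sum_(i < K) betaSR P i.
set D := \sum_(i < K) sigmaRD2 P i.
(* The coefficient of [1 / M], gathered in order from [termB], [termC], [termD], [termF] and three
   parts of [termH]. *)
exists (ES * (betaSR P k * d + betaRD P k * s) + ES * C + ER * sigmaLI2 P * d
  + (1 - alpha P) / alpha P * d * (ES * (s + T) + ER * sigmaLI2 P)
  + (1 - theta P) / theta P * ES * (s * betaRD P k / d * D)
  + (1 - theta P) / theta P * d * (ES * T + ER * sigmaLI2 P / alpha P)
  + (1 - alpha P) * (1 - theta P) / (alpha P * theta P) * d * ES * (s + T)).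
move=> M M0; have m0 : M%:R != 0 :> R by rewrite pnatr_eq0 -lt0n.
move: C S T D (M%:R) m0 => C S T D m m0.
by field; rewrite ?a0 ?t0 ?ES0 ?ER0 ?s0 ?d0 ?m0.
Qed.

Lemma limit_denominator_gt0 (R : realType) (K : nat) (P : params R K)
    (ES ER : R) (k : 'I_K) :
  0 < alpha P -> 0 < theta P <= 1 -> 0 < ES -> 0 < ER ->
  (forall i, 0 < sigmaSR2 P i) -> (forall i, 0 < sigmaRD2 P i) ->
  0 < limit_denominator P ES ER k.
Proof.
move=> a0 /andP[t0 t1] ES0 ER0 s0 d0; rewrite /limit_denominator.
have S0 : 0 <= \sum_(i < K) sigmaSR2 P i ^+ 2 * sigmaRD2 P i.
  by apply: sumr_ge0 => i _; rewrite mulr_ge0 ?exprn_ge0 // ltW.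
move: (sigmaSR2 P k) (sigmaRD2 P k) (s0 k) (d0 k) S0 => s d sk0 dk0.
move: (\sum_(i < K) _) => S S0.
(* Strict positivity comes from the first summand; the second vanishes when [theta P = 1]. *)
apply: ltr_wpDr.
  apply: divr_ge0; first by rewrite mulr_ge0 // ltW.
  by apply/ltW; rewrite !mulr_gt0.
apply: ltr_wpDr; last by rewrite divr_gt0 ?mulr_gt0.
apply: mulr_ge0; first by rewrite divr_ge0 ?subr_ge0 // ltW.
by apply/ltW; rewrite !mulr_gt0.
Qed.

(** The factor [ES * s * d / theta P], with [s] and [d] the two variances of user [k], is pulled out
    of the limit denominator and cancelled. *)
Lemma limit_sinrE (R : realType) (K : nat) (P : params R K) (ES ER : R)
    (k : 'I_K) :
  alpha P != 0 -> theta P != 0 -> ES != 0 -> ER != 0 ->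
  sigmaSR2 P k != 0 -> sigmaRD2 P k != 0 ->
  theta P
    / (1 - theta P
       + 1 / (alpha P * ES * sigmaSR2 P k)
       + (\sum_(i < K) sigmaSR2 P i ^+ 2 * sigmaRD2 P i)
         / (ER * sigmaSR2 P k ^+ 2 * sigmaRD2 P k ^+ 2))
  = ES * sigmaSR2 P k * sigmaRD2 P k / limit_denominator P ES ER k.
Proof.
move=> a0 t0 ES0 ER0 s0 d0; rewrite /limit_denominator.
move: (sigmaSR2 P k) (sigmaRD2 P k) s0 d0 => s d s0 d0.
set S := \sum_(i < K) _.
set u := 1 - theta P + _ + _.
have -> : d / (alpha P * theta P) + (1 - theta P) / theta P * (ES * s * d)
    + ES * S / (theta P * ER * s * d) = ES * s * d * (u / theta P).
  by rewrite /u; field; rewrite ?a0 ?t0 ?ES0 ?ER0 ?s0 ?d0.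
by rewrite [in RHS]invfM invf_div mulVKf // !mulf_neq0.
Qed.

Theorem corollary2 (R : realType) (K : nat) (P : params R K) (ES ER : R)
    (k : 'I_K)
    (halpha : 0 < alpha P <= 1) (htheta : 0 < theta P <= 1)
    (htaup : 0 < taup P) (htauc : 2 * taup P < tauc P)
    (hpp : 0 < pp P) (hLI : 0 <= sigmaLI2 P)
    (hSR : forall i : 'I_K, 0 < betaSR P i)
    (hRD : forall i : 'I_K, 0 < betaRD P i)
    (hES : 0 < ES) (hER : 0 < ER) :
  rate P M (ES / M%:R) (ER / M%:R) k @[M --> \oo] -->
    (tauc P - 2 * taup P) / tauc P
    * log2 (1 + theta P
        / (1 - theta P
           + 1 / (alpha P * ES * sigmaSR2 P k)
           + (\sum_(i < K) sigmaSR2 P i ^+ 2 * sigmaRD2 P i)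
             / (ER * sigmaSR2 P k ^+ 2 * sigmaRD2 P k ^+ 2))).
Proof.
have [a0 _] := andP halpha; have [t0 _] := andP htheta.
have s0 i : 0 < sigmaSR2 P i by exact: sigmaSR2_gt0.
have d0 i : 0 < sigmaRD2 P i by exact: sigmaRD2_gt0.
have L0 : 0 < limit_denominator P ES ER k by exact: limit_denominator_gt0.
rewrite limit_sinrE ?gt_eqF //.
have [|||||| c denE] := rate_denominator_affine R K P ES ER k;
  rewrite ?gt_eqF //.
set L := limit_denominator P ES ER k in L0 denE *.
set A := ES * sigmaSR2 P k * sigmaRD2 P k.
have A0 : 0 < A by exact: mulr_gt0 (mulr_gt0 hES (s0 k)) (d0 k).
(* The affine form requires [M > 0], so the sequence is shifted by one; [1 / M] then becomes
   [harmonic n]. *)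
rewrite -(cvg_shiftS (fun M => rate P M _ _ k)) /=.
have -> : (fun n => rate P n.+1 (ES / n.+1%:R) (ER / n.+1%:R) k) =
    (fun n => (tauc P - 2 * taup P) / tauc P
              * log2 (1 + A / (L + c * harmonic n))).
  apply/funext => n; rewrite /rate -/(rate_denominator _ _ _ _ _) denE //.
  by rewrite /termA divfK ?pnatr_eq0.
have den_cvg : L + c * @harmonic R n @[n --> \oo] --> L.
  rewrite -[X in _ --> X]addr0 -[X in _ + X](mulr0 c).
  apply: cvgD; first exact: cvg_cst.
  by apply: cvgM; [exact: cvg_cst | exact: cvg_harmonic].
apply: cvgM; first exact: cvg_cst.
(* The constant factor here is the [1 / ln 2] of [log2]. *)
apply: cvgM; last exact: cvg_cst.
(* Positivity of [A] and [L] puts the limit [1 + A / L] where [ln] is continuous; [L != 0] then lets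
   the quotient converge. *)
apply: continuous_cvg; first by apply: continuous_ln; rewrite addr_gt0 ?divr_gt0.
apply: cvgD; first exact: cvg_cst.
by apply: cvgM; [exact: cvg_cst | apply: cvgV]; rewrite ?gt_eqF.
Qed.
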